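(* Let $K$ be an arbitrary field. Let $P(X,Y)\in K[[X,Y]]$ and $f(X)\in K[[X]]$ be such that $f(0)=0$, $P(X,f(X))=f(X)$ and $P'_Y(0,0)=0$. Then for every integer $n\geq 0$, $$[X^n]f=\sum_{m\geq 1}[X^nY^{m-1}]\bigl(1-P'_Y(X,Y)\bigr)P(X,Y)^m .$$ If moreover the characteristic of $K$ is $0$, then also, for every integer $n\geq 0$, $$[X^n]f=\sum_{m\geq 1}\frac{1}{m}\,[X^nY^{m-1}]P(X,Y)^m .$$
   Context: $K[[X]]$ and $K[[X,Y]]$ are the rings of formal power series over $K$. $P'_Y$ denotes the formal partial derivative of $P$ with respect to $Y$. $P(X,f(X))$ denotes substitution of the power series $f$ (which has zero constant term) for $Y$. $[X^n]f$ denotes the coefficient of $X^n$ in $f$, and $[X^nY^k]G$ denotes the coefficient of $X^nY^k$ in $G\in K[[X,Y]]$. Under the stated hypotheses, for each $n$ only finitely many terms of each of the two sums over $m$ are nonzero, so the sums are understood as finite sums in $K$. *)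

(* Defs.v *)
From HB Require Import structures.
From mathcomp Require Import all_boot all_order all_algebra.
From mathcomp Require Import boolp classical_sets cardinality fsbigop.

Set Implicit Arguments.
Unset Strict Implicit.
Unset Printing Implicit Defensive.
Import Order.TTheory GRing.Theory Num.Theory.
Local Open Scope classical_set_scope.
Local Open Scope ring_scope.

Record fps (R : Type) := Fps { fcoefX : nat -> R }.

Lemma fps_ext (R : Type) (f g : fps R) : fcoefX f =1 fcoefX g -> f = g.
Proof. by case: f g => f [g] /= fg; congr Fps; exact: funext. Qed.

HB.instance Definition _ (R : Type) := gen_eqMixin (fps R).
HB.instance Definition _ (R : Type) := gen_choiceMixin (fps R).

Section FpsRing.
Variable R : comNzRingType.
Implicit Types f g h : fps R.

Definition fps_zero : fps R := Fps (fun=> 0).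
Definition fps_one : fps R := Fps (fun n => (n == 0)%:R).
Definition fps_add f g : fps R := Fps (fun n => fcoefX f n + fcoefX g n).
Definition fps_opp f : fps R := Fps (fun n => - fcoefX f n).
Definition fps_mul f g : fps R :=
  Fps (fun n => \sum_(i < n.+1) fcoefX f i * fcoefX g (n - i)).

(* The multiplicative ring axioms are transferred from {poly R}, through the
   truncation of a power series to its first N coefficients. *)
Definition fps_trunc N f : {poly R} := \poly_(i < N) fcoefX f i.

Lemma coef_trunc N f i : (i < N)%N -> (fps_trunc N f)`_i = fcoefX f i.
Proof. by rewrite coef_poly => ->. Qed.

Lemma coef_trunc_mul (p q : {poly R}) f g n :
    (forall i, (i <= n)%N -> p`_i = fcoefX f i) ->
    (forall i, (i <= n)%N -> q`_i = fcoefX g i) ->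
  forall i, (i <= n)%N -> (p * q)`_i = fcoefX (fps_mul f g) i.
Proof.
move=> pf qg i ilen; rewrite coefM; apply: eq_bigr => j _.
have jlei : (j <= i)%N by rewrite -ltnS.
by rewrite pf ?qg // ?(leq_trans _ ilen) ?leq_subr.
Qed.

Let truncP n f i : (i <= n)%N -> (fps_trunc n.+1 f)`_i = fcoefX f i.
Proof. by move=> ilen; exact: coef_trunc. Qed.

Lemma fps_addA : associative fps_add.
Proof. by move=> f g h; apply: fps_ext => n /=; rewrite addrA. Qed.

Lemma fps_addC : commutative fps_add.
Proof. by move=> f g; apply: fps_ext => n /=; rewrite addrC. Qed.

Lemma fps_add0 : left_id fps_zero fps_add.
Proof. by move=> f; apply: fps_ext => n /=; rewrite add0r. Qed.

Lemma fps_addN : left_inverse fps_zero fps_opp fps_add.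
Proof. by move=> f; apply: fps_ext => n /=; rewrite addNr. Qed.

HB.instance Definition _ :=
  GRing.isZmodule.Build (fps R) fps_addA fps_addC fps_add0 fps_addN.

Lemma fps_mulA : associative fps_mul.
Proof.
move=> f g h; apply: fps_ext => n; have T := @truncP n.
rewrite -(coef_trunc_mul (T f) (coef_trunc_mul (T g) (T h)) (leqnn n)).
by rewrite mulrA (coef_trunc_mul (coef_trunc_mul (T f) (T g)) (T h)).
Qed.

Lemma fps_mulC : commutative fps_mul.
Proof.
move=> f g; apply: fps_ext => n; have T := @truncP n.
by rewrite -(coef_trunc_mul (T f) (T g)) // mulrC (coef_trunc_mul (T g) (T f)).
Qed.

Lemma fps_mul1 : left_id fps_one fps_mul.
Proof.
move=> f; apply: fps_ext => n /=.
rewrite big_ord_recl mul1r subn0 big1 ?addr0 // => i _.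
by rewrite mul0r.
Qed.

Lemma fps_mulDl : left_distributive fps_mul fps_add.
Proof.
move=> f g h; apply: fps_ext => n /=.
by rewrite -big_split; apply: eq_bigr => i _; rewrite mulrDl.
Qed.

Lemma fps_one_neq0 : fps_one != fps_zero.
Proof. by apply/eqP => /(congr1 (fun f => fcoefX f 0)) /eqP; rewrite oner_eq0. Qed.

HB.instance Definition _ := GRing.Zmodule_isComNzRing.Build (fps R)
  fps_mulA fps_mulC fps_mul1 fps_mulDl fps_one_neq0.

Lemma fcoefX0 n : fcoefX (0 : fps R) n = 0. Proof. by []. Qed.
Lemma fcoefX1 n : fcoefX (1 : fps R) n = (n == 0)%:R. Proof. by []. Qed.
Lemma fcoefXD f g n : fcoefX (f + g) n = fcoefX f n + fcoefX g n.
Proof. by []. Qed.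
Lemma fcoefXN f n : fcoefX (- f) n = - fcoefX f n. Proof. by []. Qed.
Lemma fcoefXM f g n :
  fcoefX (f * g) n = \sum_(i < n.+1) fcoefX f i * fcoefX g (n - i).
Proof. by []. Qed.

Lemma fcoefX_sum (I : Type) (r : seq I) (A : pred I) (F : I -> fps R) n :
  fcoefX (\sum_(i <- r | A i) F i) n = \sum_(i <- r | A i) fcoefX (F i) n.
Proof. exact: (big_morph (fun f => fcoefX f n)). Qed.

Lemma fcoefX_exp_gt f k n : fcoefX f 0 = 0 -> (n < k)%N -> fcoefX (f ^+ k) n = 0.
Proof.
move=> f0; elim: k n => // k IHk n nltk; rewrite exprS fcoefXM big1 // => -[i].
case: i => [|i] /= iltn _; first by rewrite f0 mul0r.
rewrite IHk ?mulr0 //; apply: leq_trans (nltk : (n <= k)%N).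
by rewrite ltn_subrL /= (leq_ltn_trans (leq0n i)).
Qed.

End FpsRing.

(* K[[X, Y]] is K[[X]][[Y]]: the outer variable is Y, so the coefficient of
   X^n Y^k in G is the n-th coefficient of the k-th coefficient of G. *)
Definition fcoefXY (R : Type) (G : fps (fps R)) (n k : nat) : R :=
  fcoefX (fcoefX G k) n.

Lemma fcoefXYM (R : comNzRingType) (F G : fps (fps R)) n k :
  fcoefXY (F * G) n k =
  \sum_(i < n.+1) \sum_(j < k.+1) fcoefXY F i j * fcoefXY G (n - i) (k - j).
Proof.
by rewrite /fcoefXY fcoefXM fcoefX_sum exchange_big; apply: eq_bigr => j _.
Qed.

Definition derivY (R : comNzRingType) (G : fps (fps R)) : fps (fps R) :=
  Fps (fun k => fcoefX G k.+1 *+ k.+1).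

Lemma fcoefXMn (R : comNzRingType) (f : fps R) m n :
  fcoefX (f *+ m) n = fcoefX f n *+ m.
Proof. by elim: m => // m IHm; rewrite !mulrS fcoefXD IHm. Qed.

Lemma fcoefXY_derivY (R : comNzRingType) (G : fps (fps R)) n k :
  fcoefXY (derivY G) n k = fcoefXY G n k.+1 *+ k.+1.
Proof. exact: fcoefXMn. Qed.

(* P(X, f(X)) = \sum_k P_k(X) f(X)^k where P = \sum_k P_k(X) Y^k. When f has zero
   constant term, each coefficient is a finitely supported sum (see substYE);
   otherwise the value is not meaningful. *)
Definition substY (R : comNzRingType) (P : fps (fps R)) (f : fps R) : fps R :=
  Fps (fun n => \sum_(k \in [set: nat]) fcoefX (fcoefX P k * f ^+ k) n).

Lemma substYE (R : comNzRingType) (P : fps (fps R)) (f : fps R) n N :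
    fcoefX f 0 = 0 -> (n < N)%N ->
  fcoefX (substY P f) n = \sum_(k < N) fcoefX (fcoefX P k * f ^+ k) n.
Proof.
move=> f0 nltN; rewrite (fsbig_ord _ _ (fun k => fcoefX (fcoefX P k * f ^+ k) n)).
apply/esym/fsbig_widen => // k [_ /=] /negP; rewrite -leqNgt => Nlek.
rewrite big1 // => i _.
rewrite fcoefX_exp_gt ?mulr0 // (leq_ltn_trans (leq_subr _ _)) //.
exact: leq_trans Nlek.
Qed.

(* s = \sum_(m >= 1) F m, a sum with finitely many nonzero terms. Finiteness is
   required explicitly, as \sum_(m \in D) is 0 by default on infinite supports. *)
Definition finsum_ge1 (R : zmodType) (F : nat -> R) (s : R) : Prop :=
  finite_set [set m | (1 <= m)%N /\ F m != 0] /\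
  s = \sum_(m \in [set m | (1 <= m)%N]) F m.

(* Main.v *)
Require Import Defs.
From mathcomp Require Import all_boot all_order all_algebra.
From mathcomp Require Import boolp classical_sets cardinality fsbigop.
From mathcomp Require Import zify ring.
Set Implicit Arguments.
Unset Strict Implicit.
Unset Printing Implicit Defensive.
Import Order.TTheory GRing.Theory Num.Theory.
Local Open Scope ring_scope.

(** Since [P(X, f) = f], the series [P - f] is divisible by [Y - f]
    ([factor_theoremY]), say [P = f + (Y - f) V], and so [Y - P = (Y - f) U]
    where [U = 1 - V].  The first sum over [m] is, formally, the residue in [Y]
    of [P (1 - P'_Y) / (Y - P)], where [1 / (Y - P)] is expanded in powers of
    [P / Y].  As [1 - P'_Y] is the derivative of [(Y - f) U], the logarithmic
    derivative [(1 - P'_Y) / (Y - P)] is [1 / (Y - f) + U'_Y / U].  The second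
    term has no pole because [U(0, 0) = 1], and the first one contributes the
    value of [P] at [Y = f], which is [f].

    To make this rigorous without Laurent series, [geomY P G j] stands for the
    coefficient of [Y^j] in [G / (1 - P / Y)], so that [geomY P G 0] is the
    residue of [G / (Y - P)].  These infinite sums are finite in each degree
    because [P] has order at least 2 when [X] has weight 2 and [Y] has weight 1
    ([wordge]).  They are governed by the identity
    [(1 - P / Y) * (1 - P / Y)^-1 = 1] ([geomY_mulY], [geomY_mulP],
    [geomY0_mulY]), from which two facts follow: the residue vanishes on all
    multiples of [Y - f] ([geomY_root]), and it is 1 on [U] ([geomY_cofactor]).
    They suffice, because [(1 - P'_Y) P] is [f U] modulo [Y - f]
    ([geomY_lagrange]).

    In characteristic 0, [P'_Y P^m] is the derivative of [P^(m+1) / (m+1)], so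
    the terms of the two sums differ by a telescoping one. *)

(** * Series in Y with coefficients in K[[X]] *)

Section Bivariate.
Variable R : comNzRingType.
Implicit Types (f g : fps R) (F G P : fps (fps R)).

Definition Yser : fps (fps R) := Fps (fun k => (k == 1%N)%:R).
Definition constY f : fps (fps R) := Fps (fun k => if k == 0%N then f else 0).

Lemma coef_constYM f G k : fcoefX (constY f * G) k = f * fcoefX G k.
Proof.
rewrite fcoefXM big_ord_recl /= subn0 big1 ?addr0 // => i _.
by rewrite mul0r.
Qed.

Lemma coef0_YserM G : fcoefX (Yser * G) 0 = 0.
Proof. by rewrite fcoefXM big_ord1 mul0r. Qed.

Lemma coefS_YserM G k : fcoefX (Yser * G) k.+1 = fcoefX G k.
Proof.
rewrite fcoefXM big_ord_recl mul0r add0r big_ord_recl /= mul1r subn1 /=.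
by rewrite big1 ?addr0 // => i _; rewrite mul0r.
Qed.

Lemma derivYM F G : derivY (F * G) = derivY F * G + F * derivY G.
Proof.
apply: fps_ext => k /=.
have -> : fcoefX (F * G) k.+1 *+ k.+1 =
  \sum_(i < k.+2) (fcoefX F i *+ i) * fcoefX G (k.+1 - i) +
  \sum_(i < k.+2) fcoefX F i * (fcoefX G (k.+1 - i) *+ (k.+1 - i)).
  (* The factor [k + 1] splits as [i + (k + 1 - i)]. *)
  rewrite -big_split fcoefXM -sumrMnl; apply: eq_bigr => i _ /=.
  by rewrite mulrnAl mulrnAr -mulrnDr subnKC // -ltnS.
congr (_ + _).
  by rewrite big_ord_recl mulr0n mul0r add0r.
rewrite big_ord_recr /= subnn mulr0n mulr0 addr0.
by apply: eq_bigr => i _; rewrite subSn // -ltnS.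
Qed.

Lemma derivYD F G : derivY (F + G) = derivY F + derivY G.
Proof. by apply: fps_ext => k /=; rewrite mulrnDl. Qed.

Lemma derivYN F : derivY (- F) = - derivY F.
Proof. by apply: fps_ext => k /=; rewrite mulNrn. Qed.

Lemma derivY_const f : derivY (constY f) = 0.
Proof. by apply: fps_ext => k /=; rewrite mul0rn. Qed.

Lemma derivY_Yser : derivY Yser = 1.
Proof. by apply: fps_ext => -[|k] //=; rewrite mul0rn. Qed.

Lemma derivY_exp F m : derivY (F ^+ m.+1) = (derivY F * F ^+ m) *+ m.+1.
Proof.
elim: m => [|m IHm]; first by rewrite expr1 expr0 mulr1.
by rewrite exprS derivYM IHm mulrnAr mulrCA -exprS [RHS]mulrS.
Qed.

Lemma fcoefXYMn G m n k : fcoefXY (G *+ m) n k = fcoefXY G n k *+ m.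
Proof. by rewrite /fcoefXY (fcoefXMn G m k) fcoefXMn. Qed.

(** * Division by Y - f *)

Definition shiftY G : fps (fps R) := Fps (fun k => fcoefX G k.+1).

(** Horner's rule for a power series. *)
Lemma substY_horner P f : fcoefX f 0 = 0 ->
  substY P f = fcoefX P 0 + f * substY (shiftY P) f.
Proof.
move=> f0; apply: fps_ext => n; rewrite fcoefXD.
rewrite (@substYE _ P f n n.+2) // big_ord_recl expr0 mulr1; congr (_ + _).
rewrite fcoefXM.
under [RHS]eq_bigr => i _.
  rewrite (@substYE _ (shiftY P) f (n - i) n.+1) ?ltnS ?leq_subr //.
  rewrite mulr_sumr; over.
rewrite [RHS]exchange_big; apply: eq_bigr => k _.
by rewrite lift0 exprS mulrCA fcoefXM.
Qed.

(** The coefficients are those which Horner's rule produces, i.e., those of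
    [(P(X, Y) - P(X, f)) / (Y - f)]. *)
Definition quotY P f : fps (fps R) :=
  Fps (fun k => substY (iter k.+1 shiftY P) f).

Lemma coef_iter_shiftY P j k : fcoefX (iter j shiftY P) k = fcoefX P (j + k).
Proof. by elim: j k => // j IHj k /=; rewrite IHj addnS. Qed.

Lemma quotY_rec P f k : fcoefX f 0 = 0 ->
  fcoefX (quotY P f) k = fcoefX P k.+1 + f * fcoefX (quotY P f) k.+1.
Proof.
by move=> f0; rewrite [LHS]substY_horner // coef_iter_shiftY addn0.
Qed.

Lemma factor_theoremY P f : fcoefX f 0 = 0 ->
  P = constY (substY P f) + (Yser - constY f) * quotY P f.
Proof.
move=> f0; apply: fps_ext => k.
rewrite mulrBl !(fcoefXD, fcoefXN) coef_constYM.
case: k => [|k]; last first.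
  by rewrite coefS_YserM quotY_rec // add0r addrK.
by rewrite coef0_YserM sub0r [substY P f in RHS]substY_horner // addrK.
Qed.

(** * The order with X of weight 2 and Y of weight 1 *)

(** With these weights, [P^m] has order at least [2 m] when [P] has neither a
    constant term nor a term in [Y]; this outgrows the weight [m] of [Y^m], and
    makes the sums over [m] finite. *)
Definition wordge w G := forall n k, (n.*2 + k < w)%N -> fcoefXY G n k = 0.

Lemma wordge0 G : wordge 0 G. Proof. by []. Qed.

Lemma wordgeM v w F G : wordge v F -> wordge w G -> wordge (v + w) (F * G).
Proof.
move=> vF wG n k lt_nk; rewrite fcoefXYM big1 // => i _; rewrite big1 // => j _.
case: (ltnP (i.*2 + j) v) => [/vF -> | le_v]; first by rewrite mul0r.
rewrite wG ?mulr0 //; move: (ltn_ord i) (ltn_ord j) => ltin ltjk; lia.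
Qed.

Lemma wordgeX w G m : wordge w G -> wordge (m * w) (G ^+ m).
Proof.
move=> wG; elim: m => // m IHm; rewrite exprS mulSn; exact: wordgeM.
Qed.

(** * The coefficients of G / (1 - P / Y) *)

(** The coefficient of [Y^j] in the sum over [m >= 0] of [G * (P / Y)^m].  Only
    the terms with [m <= 2 n + j] can contribute to its coefficient of [X^n],
    when [P] has weighted order at least 2. *)
Definition geomY P G j : fps R :=
  Fps (fun n => \sum_(m < (n.*2 + j).+1) fcoefXY (G * P ^+ m) n (m + j)).

Section Geometric.
Variable P : fps (fps R).
Hypothesis P2 : wordge 2 P.

Lemma coef_mulX_eq0 w G n m j : wordge w G -> (n.*2 + j < w + m)%N ->
  fcoefXY (G * P ^+ m) n (m + j) = 0.
Proof.
move=> wG ltw; have := @wordgeM w (m * 2) G (P ^+ m) wG (wordgeX P2).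
by apply; lia.
Qed.

Lemma geomYE G j n N : (n.*2 + j < N)%N ->
  fcoefX (geomY P G j) n = \sum_(m < N) fcoefXY (G * P ^+ m) n (m + j).
Proof.
move=> ltN /=; rewrite -!(big_mkord xpredT (fun m => fcoefXY (G * P ^+ m) n (m + j))).
rewrite [RHS](big_cat_nat (leq0n _) ltN) /= -[LHS]addr0; congr (_ + _).
rewrite big_nat big1 // => m /andP[lem _].
exact: (coef_mulX_eq0 (@wordge0 G)).
Qed.

Lemma geomYD F G j : geomY P (F + G) j = geomY P F j + geomY P G j.
Proof.
apply: fps_ext => n /=; rewrite -big_split; apply: eq_bigr => m _.
by rewrite mulrDl.
Qed.

Lemma geomYN G j : geomY P (- G) j = - geomY P G j.
Proof.
apply: fps_ext => n /=; rewrite -sumrN; apply: eq_bigr => m _.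
by rewrite mulNr.
Qed.

Lemma geomYB F G j : geomY P (F - G) j = geomY P F j - geomY P G j.
Proof. by rewrite geomYD geomYN. Qed.

Lemma geomYZ f G j : geomY P (constY f * G) j = f * geomY P G j.
Proof.
apply: fps_ext => n; rewrite fcoefXM.
under [RHS]eq_bigr => i _.
  (* A common number of terms for all coefficients up to [X^n]. *)
  rewrite (@geomYE G j (n - i) (n.*2 + j).+1); last by lia.
  rewrite mulr_sumr; over.
rewrite [RHS]exchange_big; apply: eq_bigr => m _.
by rewrite -mulrA /fcoefXY coef_constYM.
Qed.

Lemma geomY_eq0 w G j n : wordge w G -> (n.*2 + j < w)%N ->
  fcoefX (geomY P G j) n = 0.
Proof.
move=> wG ltw; rewrite /= big1 // => m _; apply: (coef_mulX_eq0 wG); lia.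
Qed.

Lemma geomY_mulY G j : geomY P (Yser * G) j.+1 = geomY P G j.
Proof.
apply: fps_ext => n.
rewrite !(@geomYE _ _ n (n.*2 + j).+2) ?addnS //; apply: eq_bigr => m _.
by rewrite -mulrA addnS /fcoefXY coefS_YserM.
Qed.

(** Multiplying by [P / Y] shifts the index of summation, hence loses the term
    of index [m = 0]. *)
Lemma geomY_mulP G j : geomY P (P * G) j.+1 = geomY P G j - fcoefX G j.
Proof.
apply: fps_ext => n; rewrite fcoefXD fcoefXN.
rewrite (@geomYE _ _ n (n.*2 + j).+2) ?addnS //.
rewrite (@geomYE _ _ n (n.*2 + j).+3) //; last by lia.
rewrite [\sum_(m < _.+3) _]big_ord_recl expr0 mulr1 add0n addrAC subrr add0r.
by apply: eq_bigr => m _; rewrite lift0 exprS mulrA (mulrC P G) addnS addSn.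
Qed.

(** For the residue the lost term is the coefficient of [Y^-1] in [G], which is
    0: the residue of a multiple of [Y - P] vanishes. *)
Lemma geomY0_mulY G : geomY P (Yser * G) 0 = geomY P (P * G) 0.
Proof.
apply: fps_ext => n.
rewrite (@geomYE _ _ n n.*2.+2) ?addn0 // [RHS](@geomYE _ _ n n.*2.+1) ?addn0 //.
rewrite big_ord_recl addn0 -mulrA {1}/fcoefXY coef0_YserM add0r.
apply: eq_bigr => m _.
by rewrite lift0 -mulrA !addn0 /fcoefXY coefS_YserM exprS mulrA (mulrC P G).
Qed.

End Geometric.

(** * The residue at the fixed point *)

Section FixedPoint.
Variables (P : fps (fps R)) (f : fps R).
Hypotheses (P2 : wordge 2 P) (f0 : fcoefX f 0 = 0) (Pf : substY P f = f).

Local Notation V := (quotY P f).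
Local Notation Yf := (Yser - constY f).

Let defP : P = constY f + Yf * V.
Proof. by rewrite {1}(factor_theoremY P f0) Pf. Qed.

Let cofactor : Yf * (1 - V) = Yser - P.
Proof. by rewrite [in RHS]defP; ring. Qed.

Lemma quotY_wordge1 : wordge 1 V.
Proof.
move=> [|n] [|k] // _; rewrite /fcoefXY quotY_rec // fcoefXD fcoefXM big_ord1.
rewrite f0 mul0r addr0; exact: (@P2 0 1 isT).
Qed.

(** Modulo [Y - P = (Y - f) (1 - V)], a multiple of [Y - f] is unchanged by
    multiplication by [V]; and high powers of [V] have high order. *)
Lemma geomY_root G : geomY P (Yf * G) 0 = 0.
Proof.
have mulV H : geomY P (Yf * H) 0 = geomY P (Yf * (V * H)) 0.
  apply/eqP; rewrite -subr_eq0 -geomYB.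
  have -> : Yf * H - Yf * (V * H) = Yser * H - P * H by rewrite -mulrBl -cofactor; ring.
  by rewrite geomYB geomY0_mulY // subrr.
have mulVX k : geomY P (Yf * G) 0 = geomY P (Yf * (V ^+ k * G)) 0.
  by elim: k => [|k ->]; rewrite ?mul1r // mulV exprS -mulrA.
apply: fps_ext => n; rewrite (mulVX n.*2.+1).
have := wordgeM (@wordge0 Yf)
  (wordgeM (wordgeX (m := n.*2.+1) quotY_wordge1) (@wordge0 G)).
by move/(geomY_eq0 P2); apply; lia.
Qed.

(** [(1 - V) / (1 - P / Y) = 1 / (1 - f / Y)], hence the coefficients of the
    left-hand side satisfy the recurrence of the geometric series of ratio
    [f / Y]. *)
Lemma geomY_cofactor_rec j :
  geomY P (1 - V) j = f * geomY P (1 - V) j.+1 + (j == 0%N)%:R.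
Proof.
move: (1 - V) cofactor => U YfU.
have : geomY P (Yser * U - constY f * U) j.+1 =
    geomY P (Yser * 1 - P * 1) j.+1 by rewrite !mulr1 -mulrBl YfU.
rewrite !geomYB geomYZ // !geomY_mulY // geomY_mulP // subKr.
by move/(canRL (subrK _)) => ->; rewrite addrC.
Qed.

(** By the recurrence, the coefficients of positive index are divisible by all
    powers of [f], hence vanish. *)
Lemma geomY_cofactor : geomY P (1 - V) 0 = 1.
Proof.
have pos k j : geomY P (1 - V) j.+1 = f ^+ k * geomY P (1 - V) (j.+1 + k).
  elim: k => [|k ->]; first by rewrite mul1r addn0.
  by rewrite geomY_cofactor_rec addSn addr0 mulrA -exprSr addnS.
rewrite geomY_cofactor_rec; suff -> : geomY P (1 - V) 1 = 0 by rewrite mulr0 add0r.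
apply: fps_ext => n; rewrite (pos n.+1) fcoefXM big1 // => i _.
by rewrite fcoefX_exp_gt ?mul0r.
Qed.

(** The Lagrange inversion formula as a residue: [P'_Y = V + (Y - f) V'_Y], so
    that [(1 - P'_Y) P] is [(1 - V) f] modulo [Y - f]. *)
Theorem geomY_lagrange : geomY P ((1 - derivY P) * P) 0 = f.
Proof.
have dP : derivY P = V + Yf * derivY V.
  rewrite [P in LHS]defP derivYD derivY_const add0r derivYM.
  by rewrite derivYD derivYN derivY_const derivY_Yser subr0 mul1r.
have -> : (1 - derivY P) * P =
    constY f * (1 - V) + Yf * ((1 - V) * V - derivY V * P).
  rewrite dP; move: (derivY V) V defP => V' W ->; ring.
by rewrite geomYD geomY_root addr0 geomYZ // geomY_cofactor mulr1.
Qed.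

End FixedPoint.
End Bivariate.

(** * The sums over m *)

Lemma finsum_ge1P (R : zmodType) (F : nat -> R) (s : R) N :
    (forall m, (N <= m)%N -> F m.+1 = 0) -> s = \sum_(m < N) F m.+1 ->
  finsum_ge1 F s.
Proof.
move=> F0 ->; have memr i : (i \in [seq m.+1 | m <- iota 0 N]) = (0 < i <= N)%N.
  case: i => [|i]; first by apply/mapP => -[].
  by rewrite (mem_map succn_inj) mem_iota.
split.
  apply: (sub_finite_set _ (finite_II N.+1)) => -[|m] [] //= _.
  by apply: contraNT; rewrite -leqNgt ltnS => /F0 ->.
rewrite (fsbigE [seq m.+1 | m <- iota 0 N]) ?(map_inj_uniq succn_inj) ?iota_uniq //.
- rewrite big_map -(big_mkord xpredT (fun m => F m.+1)) /index_iota subn0.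
  by apply: eq_bigl => i; apply/esym/mem_set.
- by move=> i /=; rewrite memr => /andP[].
- by case=> // i _; rewrite memr /= -leqNgt => /F0.
Qed.

Theorem theorem1 (K : fieldType) (P : fps (fps K)) (f : fps K)
    (f0 : fcoefX f 0 = 0) (Pf : substY P f = f)
    (dP0 : fcoefXY (derivY P) 0 0 = 0) :
  (forall n : nat,
     finsum_ge1 (fun m => fcoefXY ((1 - derivY P) * P ^+ m) n (m - 1)) (fcoefX f n))
  /\
  ([pchar K] =i pred0 ->
   forall n : nat,
     finsum_ge1 (fun m => (m%:R)^-1 * fcoefXY (P ^+ m) n (m - 1)) (fcoefX f n)).
Proof.
have P2 : wordge 2 P.
  (* The coefficient of [Y] is, up to conversion, the one in [dP0]. *)
  move=> [|n] [|[|k]] //.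
  by rewrite -[RHS]f0 -Pf (@substYE _ P f 0 1) // big_ord1 expr0 mulr1.
have coef_gt G n m : (n.*2 < m)%N -> fcoefXY (G * P ^+ m.+1) n m = 0.
  have := @coef_mulX_eq0 _ P P2 0 (G * P) n m 0.
  by rewrite !addn0 add0n -mulrA -exprS; apply.
have sumf n : fcoefX f n =
    \sum_(m < n.*2.+1) fcoefXY ((1 - derivY P) * P ^+ m.+1) n m.
  rewrite -{1}(geomY_lagrange P2 f0 Pf) (@geomYE _ P P2 _ _ n n.*2.+1) ?addn0 //.
  by apply: eq_bigr => m _; rewrite addn0 -mulrA -exprS.
split=> [n|pchar0 n].
  apply: (@finsum_ge1P _ _ _ n.*2.+1) => [m lem|]; first by rewrite subn1 coef_gt.
  by rewrite sumf; apply: eq_bigr => m _; rewrite subn1.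
have natS_neq0 m : m.+1%:R != 0 :> K by move/pcharf0P: pchar0 => ->.
apply: (@finsum_ge1P _ _ _ n.*2.+1) => [m lem|].
  by rewrite subn1 -[P ^+ _]mul1r coef_gt ?mulr0.
(* As [b 0 = 0], and [b m = 0] beyond the last term, the sum of the differences
   [b m - b m.+1] vanishes. *)
rewrite sumf; pose a m := fcoefXY (P ^+ m.+1) n m.
pose b m := (m%:R / m.+1%:R) * a m.
have term m : fcoefXY ((1 - derivY P) * P ^+ m.+1) n m =
    (m.+1%:R)^-1 * a m + (b m - b m.+1).
  have -> : fcoefXY ((1 - derivY P) * P ^+ m.+1) n m =
      a m - fcoefXY (derivY P * P ^+ m.+1) n m by rewrite mulrBl mul1r.
  have -> : fcoefXY (derivY P * P ^+ m.+1) n m = b m.+1.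
    apply: (mulfI (natS_neq0 m.+1)).
    have := congr1 (fun G => fcoefXY G n m) (derivY_exp P m.+1).
    rewrite fcoefXY_derivY fcoefXYMn -[LHS]mulr_natl -[RHS]mulr_natl => <-.
    by rewrite /b [in RHS]mulrA mulrCA divff // mulr1.
  rewrite addrA -mulrDl; congr (_ - _).
  by rewrite -[X in X + _]mul1r -mulrDl addrC natr1 divff // mul1r.
have sumb N : \sum_(m < N) (b m - b m.+1) = - b N.
  elim: N => [|N IHN]; first by rewrite big_ord0 /b !mul0r oppr0.
  by rewrite big_ord_recr IHN /= addrA addNr add0r.
under eq_bigr => m _ do rewrite term.
rewrite big_split /= sumb /b /a -[P ^+ _]mul1r coef_gt // mulr0 oppr0 addr0.
by apply: eq_bigr => m _; rewrite subn1.
Qed.
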